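(* The equivalence relation $\Delta_{\mathbb{R}}^+$ is Borel bireducible with the topological conjugacy relation $\cong_{tc}^*$ on the standard Borel space $\mathcal{M}^*_{2^{\mathbb{N}}}$ of pointed Cantor minimal systems; i.e. each is Borel reducible to the other.
   Context: A pointed Cantor minimal system is a triple $(X,\varphi,x)$ where $X$ is a Cantor space, $\varphi:X\to X$ is a minimal homeomorphism (no non-empty proper closed $\varphi$-invariant subsets), and $x\in X$. Two pointed systems $(X,\varphi,x)$, $(Y,\psi,y)$ are (pointed) topologically conjugate if there is a homeomorphism $\pi:X\to Y$ with $\pi\circ\varphi=\psi\circ\pi$ and $\pi(x)=y$. Let $\mathbb{B}$ be the Boolean algebra of clopen subsets of $2^{\mathbb{N}}$; $H(2^{\mathbb{N}})$ is identified with $\mathrm{Aut}(\mathbb{B})$, a $G_\delta$ subset of $\mathbb{B}^{\mathbb{B}}$, hence Polish; $\mathcal{M}_{2^{\mathbb{N}}}\subseteq H(2^{\mathbb{N}})$ is the Borel set of minimal homeomorphisms, and $\mathcal{M}^*_{2^{\mathbb{N}}}=\mathcal{M}_{2^{\mathbb{N}}}\times 2^{\mathbb{N}}$ with the product standard Borel structure; $\cong_{tc}^*$ is pointed topological conjugacy on it. $\Delta_{\mathbb{R}}^+$ is the equivalence relation on $\mathbb{R}^{\mathbb{N}}$ with $x\,\Delta_{\mathbb{R}}^+\,y\iff\{x_i:i\in\mathbb{N}\}=\{y_i:i\in\mathbb{N}\}$. $E$ is Borel reducible to $F$ if there is a Borel map $f$ with $x\,E\,y\iff f(x)\,F\,f(y)$;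 Borel bireducible means reducible in both directions. *)

(* Defs.v *)
From HB Require Import structures.
From mathcomp Require Import all_boot all_order all_algebra.
From mathcomp Require Import all_classical all_reals all_analysis.

Set Implicit Arguments.
Unset Strict Implicit.
Unset Printing Implicit Defensive.

Import numFieldNormedType.Exports.

Local Open Scope classical_set_scope.

Definition homeomorphism (T U : topologicalType) (f : T -> U) : Prop :=
  continuous f /\
  exists g : U -> T, [/\ continuous g, cancel f g & cancel g f].

(* For homeomorphisms of compact spaces, requiring f @` F = F instead would
   give the same notion of minimality. *)
Definition minimal (T : topologicalType) (f : T -> T) : Prop :=
  forall F : set T, closed F -> f @` F `<=` F -> F = set0 \/ F = setT.

Definition pointed_conjugate (T U : topologicalType)
    (phi : T -> T) (x : T) (psi : U -> U) (y : U) : Prop :=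
  exists pi : T -> U,
    [/\ homeomorphism pi, forall z, pi (phi z) = psi (pi z) & pi x = y].

Definition borel_reducible d1 d2
    (X : measurableType d1) (Y : measurableType d2)
    (E : X -> X -> Prop) (F : Y -> Y -> Prop) : Prop :=
  exists2 f : X -> Y, measurable_fun [set: X] f &
    forall x y, E x y <-> F (f x) (f y).

Definition borel_bireducible d1 d2
    (X : measurableType d1) (Y : measurableType d2)
    (E : X -> X -> Prop) (F : Y -> Y -> Prop) : Prop :=
  borel_reducible E F /\ borel_reducible F E.

Definition real_seq (R : realType) : measurableType _ :=
  g_sigma_algebraType (@open (prod_topology (fun _ : nat => R))).

Definition Delta_plus (R : realType) (x y : nat -> R) : Prop :=
  range x = range y.

Definition cantor_clopen : Type :=
  set_type [set A : set cantor_space | clopen A].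
HB.instance Definition _ := Choice.on cantor_clopen.

Lemma clopen_set0 :
  (set0 : set cantor_space) \in [set A | @clopen cantor_space A].
Proof. by rewrite inE; exact: clopen0. Qed.

HB.instance Definition _ := isPointed.Build cantor_clopen
  (exist _ set0 clopen_set0 : cantor_clopen).

(* The space B^B, where B is the discrete countable algebra of clopen sets. *)
Definition clopen_self_maps : Type :=
  prod_topology (fun _ : cantor_clopen => discrete_topology cantor_clopen).

Lemma homeomorphism_clopen (T U : topologicalType) (f : T -> U) (A : set T) :
  homeomorphism f -> clopen A -> clopen (f @` A).
Proof.
case=> _ [g [cg fK gK]] [oA cA].
have -> : f @` A = g @^-1` A.
  apply/seteqP; split=> [_ [a Aa <-]|u Au] /=; first by rewrite fK.
  by exists (g u) => //; rewrite gK.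
by split; [apply: open_comp|apply: closed_comp] => // ? _; exact: cg.
Qed.

Lemma cantor_cvg (F : set_system cantor_space) (FF : Filter F)
    (x : cantor_space) :
  (forall n, \forall y \near F, y n = x n) -> F --> x.
Proof.
move=> h; have : {ptws, F --> (x : nat -> bool)}.
  by apply/pointwise_cvgP => n; apply/discrete_cvg; exact: h.
by [].
Qed.

Lemma cantor_near (x : cantor_space) n :
  \forall y \near x, forall i, (i < n)%N -> y i = x i.
Proof.
elim: n => [|n IH]; first by near=> y.
have xn : \forall y \near x, y n = x n.
  have := @proj_continuous nat (fun _ => bool) n x.
  by move/discrete_cvg; apply.
near=> y; have yn : y n = x n by near: y.
have yi : forall i, (i < n)%N -> y i = x i by near: y.
by move=> i; rewrite ltnS leq_eqVlt => /predU1P[->|/yi].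
Unshelve. all: by end_near. Qed.

(* The binary odometer, used only to show that minimal homeomorphisms of the
   Cantor space exist. *)
Definition odometer (x : cantor_space) : cantor_space :=
  fun n => x n (+) all x (iota 0 n).

Definition odometer_inv (x : cantor_space) : cantor_space :=
  fun n => x n (+) all (fun i => ~~ x i) (iota 0 n).

Lemma odometerK : cancel odometer odometer_inv.
Proof.
move=> x; apply/funext => n; rewrite /odometer_inv.
suff -> : all (fun i => ~~ odometer x i) (iota 0 n) = all x (iota 0 n).
  by rewrite /odometer addbK.
elim: n => // n IH; rewrite -addn1 iotaD !all_cat IH /= !andbT add0n /odometer.
by case: (all _ _); case: (x n).
Qed.

Lemma odometer_invK : cancel odometer_inv odometer.
Proof.
move=> x; apply/funext => n; rewrite /odometer.
suff -> : all (odometer_inv x) (iota 0 n) = all (fun i => ~~ x i) (iota 0 n).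
  by rewrite /odometer_inv addbK.
elim: n => // n IH; rewrite -addn1 iotaD !all_cat IH /= !andbT add0n.
rewrite /odometer_inv.
by case: (all _ _); case: (x n).
Qed.

Lemma causal_continuous (f : cantor_space -> cantor_space) :
  (forall n (x y : cantor_space),
     (forall i, (i < n.+1)%N -> y i = x i) -> f y n = f x n) ->
  continuous f.
Proof.
move=> fP x; apply: cantor_cvg => n; rewrite near_map.
by apply: filterS (cantor_near x n.+1) => y; exact: fP.
Qed.

Lemma odometer_homeomorphism : homeomorphism odometer.
Proof.
split; last (exists odometer_inv; split;
    [|exact: odometerK|exact: odometer_invK]);
  apply: causal_continuous => n x y yx;
  rewrite /odometer /odometer_inv yx //; congr (_ (+) _);
  apply: eq_in_all => i; rewrite mem_iota => /= lin; rewrite yx //;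
  exact: ltnW.
Qed.

Definition odometer_shift n (x : cantor_space) : cantor_space :=
  fun i => x i (+) ((n <= i)%N && all x (iota n (i - n))).

Lemma odometer_shiftS n (x : cantor_space) :
  odometer_shift n (odometer_shift n x) = odometer_shift n.+1 x.
Proof.
apply/funext => i; set y := odometer_shift n x; rewrite /odometer_shift.
have [lin|] := ltnP i n.
  have [ni Sni] : (n <= i)%N = false /\ (n < i)%N = false.
    by rewrite leqNgt lin ltnNge ltnW.
  by rewrite /y /odometer_shift ni Sni !addbF.
rewrite leq_eqVlt => /predU1P[<-|ltni].
  by rewrite ltnn /y /odometer_shift leqnn subnn /= !addbT negbK addbF.
have -> : (i - n)%N = (i - n.+1).+1 by rewrite subnSK.
rewrite ltni /=.
have yE j : (n < j)%N -> y j = x j (+) (x n && all x (iota n.+1 (j - n.+1))).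
  by move=> ltnj; rewrite /y /odometer_shift (ltnW ltnj) -subnSK.
rewrite yE // {1}/y /odometer_shift leqnn subnn /= addbT.
case xn : (x n) => /=; first by rewrite addbF.
rewrite addbF; congr (_ (+) _); apply: eq_in_all => j.
by rewrite mem_iota => /andP[ltnj _]; rewrite yE // xn addbF.
Qed.

Lemma iter_odometer n : iter (2 ^ n) odometer =1 odometer_shift n.
Proof.
elim: n => [x|n IH x].
  by apply/funext => i; rewrite /= /odometer /odometer_shift subn0.
by rewrite expnS mul2n -addnn iterD !IH odometer_shiftS.
Qed.

Lemma odometer_reach (x y : cantor_space) n :
  exists k, forall i, (i < n)%N -> iter k odometer x i = y i.
Proof.
elim: n => [|n [k kP]]; first by exists 0%N.
have [zn|zn] := eqVneq (iter k odometer x n) (y n).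
  by exists k => i; rewrite ltnS leq_eqVlt => /predU1P[->|/kP].
exists (2 ^ n + k)%N => i; rewrite iterD iter_odometer /odometer_shift ltnS.
rewrite leq_eqVlt => /predU1P[->|lin].
  by rewrite leqnn subnn /= addbT; move: zn; case: (_ n); case: (y n).
by rewrite leqNgt lin /= addbF kP.
Qed.

Lemma odometer_minimal : minimal odometer.
Proof.
move=> F cF FF; have [->|/set0P[x Fx]] := eqVneq F set0; first by left.
right; apply/seteqP; split=> // y _.
have [k kP] := choice (odometer_reach x y).
apply: (@closed_cvg _ _ (\oo : set_system nat) _
  (fun n => iter (k n) odometer x) F cF).
  near=> n; elim: (k n) => //= m Fm; exact: FF (ex_intro2 _ _ _ Fm erefl).
apply: cantor_cvg => i; rewrite near_map; exists i.+1 => // n /= lin.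
exact: kP.
Unshelve. all: by end_near. Qed.

Definition cantor_minimal_homeo : Type :=
  set_type [set phi : cantor_space -> cantor_space |
             homeomorphism phi /\ minimal phi].
HB.instance Definition _ := Choice.on cantor_minimal_homeo.

Lemma odometer_minimal_homeo :
  odometer \in [set phi : cantor_space -> cantor_space |
                 homeomorphism phi /\ minimal phi].
Proof.
by rewrite inE; split; [exact: odometer_homeomorphism|exact: odometer_minimal].
Qed.

HB.instance Definition _ := isPointed.Build cantor_minimal_homeo
  (exist _ odometer odometer_minimal_homeo : cantor_minimal_homeo).

Lemma minimal_homeo_clopen (phi : cantor_minimal_homeo) (A : cantor_clopen) :
  set_val phi @` set_val A \in [set A | @clopen cantor_space A].
Proof.
rewrite inE; apply: homeomorphism_clopen; last exact: (set_valP A).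
by have [] := set_valP phi.
Qed.

(* Identifies a homeomorphism with the automorphism it induces of the algebra
   of clopen sets. *)
Definition clopen_action (phi : cantor_minimal_homeo) : clopen_self_maps :=
  fun A => exist _ (set_val phi @` set_val A) (minimal_homeo_clopen phi A).

(* The Borel structure on minimal homeomorphisms is the one inherited from B^B
   through this identification. *)
Definition minimal_homeo_borel : measurableType _ :=
  g_sigma_algebra_preimageType
    (clopen_action :
       cantor_minimal_homeo -> g_sigma_algebraType (@open clopen_self_maps)).

Definition pointed_minimal_system : measurableType _ :=
  (minimal_homeo_borel * g_sigma_algebraType (@open cantor_space))%type.

Definition pointed_conjugacy (s t : pointed_minimal_system) : Prop :=
  @pointed_conjugate cantor_space cantor_space
    (set_val (s.1 : cantor_minimal_homeo)) s.2
    (set_val (t.1 : cantor_minimal_homeo)) t.2.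

(* Main.v *)
Require Import Defs.
From mathcomp Require Import all_boot all_order all_algebra.
From mathcomp Require Import all_classical all_reals all_analysis.
From mathcomp Require Import lra.

(* A pointed minimal system (phi, x) is determined up to pointed conjugacy by
   the countable family of hitting sets {n | phi^n x \in A}, A clopen: two
   systems with the same family have orbits p, q such that p n |-> q n extends
   to a homeomorphism.  Coding subsets of nat by reals, this reduces pointed
   conjugacy to equality of countable sets of reals.

   Conversely, let z_n be the orbit of 0 under the binary odometer, and attach
   to each real r a point beta_r, in such a way that distinct reals give points
   in distinct orbits.  The parity of the first digit at which z differs from
   beta_r is a function of z whose only discontinuity is beta_r.  The digits of
   z_n together with these functions, for r in a countable set S and for all the
   translates of beta_r, form a Toeplitz sequence, hence a minimal system, whose
   hitting sets remember S because they see discontinuities only along the orbits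
   of the beta_r with r in S.  The orbit closure is identified with the Cantor
   space by keeping, along each branch of its tree, the digits at the splitting
   nodes. *)

Set Implicit Arguments.
Unset Strict Implicit.
Unset Printing Implicit Defensive.

Import Order.TTheory GRing.Theory Num.Theory numFieldNormedType.Exports.

Local Open Scope classical_set_scope.

(** * Continuous maps and dense orbits in the Cantor space *)

Definition agree k (x y : nat -> bool) := forall i, (i < k)%N -> x i = y i.

Lemma agree_sym k x y : agree k x y -> agree k y x.
Proof. by move=> h i /h. Qed.

Lemma agree_trans k x y z : agree k x y -> agree k y z -> agree k x z.
Proof. by move=> xy yz i ik; rewrite xy ?yz. Qed.

Lemma agree_le k l x y : (k <= l)%N -> agree l x y -> agree k x y.
Proof. by move=> kl h i ik; apply: h; exact: leq_trans kl. Qed.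

Lemma agreeS k x y : agree k.+1 x y <-> agree k x y /\ x k = y k.
Proof.
split=> [h|[h xyk] i]; first by split; [exact: agree_le h|exact: h].
by rewrite ltnS leq_eqVlt => /predU1P[->|/h].
Qed.

Lemma agree_eq x y : (forall k, agree k x y) -> x = y.
Proof. by move=> h; apply/funext => i; exact: (h i.+1). Qed.

Lemma first_disagreement k x y : ~ agree k x y ->
  exists i, [/\ (i < k)%N, agree i x y & x i != y i].
Proof.
elim: k => [[]//|k IH nxy].
have [xy|/IH[i [ik ? ?]]] := pselect (agree k x y); last first.
  by exists i; split=> //; exact: ltnW.
by exists k; split=> //; apply/negP => /eqP xyk; apply/nxy/agreeS.
Qed.

Lemma common_modulus (P : nat -> nat -> Prop) :
  (forall i K L, (K <= L)%N -> P i K -> P i L) ->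
  (forall i, exists K, P i K) -> forall J, exists K, forall i, (i < J)%N -> P i K.
Proof.
move=> mono ex; elim=> [|J [K KP]]; first by exists 0%N.
have [L LP] := ex J; exists (maxn K L) => i.
rewrite ltnS leq_eqVlt => /predU1P[->|iJ].
  exact: mono (leq_maxr _ _) LP.
exact: mono (leq_maxl _ _) (KP _ iJ).
Qed.

(** The filter generated by the cylinders around [x] converges to [x] digit by digit, so it refines
    the neighbourhood filter. From here on topology is handled through common prefixes. *)
Lemma nbhs_agreeP (x : cantor_space) (A : set cantor_space) :
  nbhs x A <-> exists K, forall y, agree K x y -> A y.
Proof.
split=> [xA|[K KA]]; last first.
  by apply: filterS (cantor_near x K) => y xy; apply/KA/agree_sym.
pose F := filter_from [set: nat] (fun K => [set y : cantor_space | agree K x y]).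
have FF : Filter F.
  apply: filter_from_filter; first by exists 0%N.
  move=> i j _ _; exists (maxn i j) => // y /= xy.
  by split; apply: agree_le xy; rewrite ?leq_maxl ?leq_maxr.
have : F --> x.
  by apply: cantor_cvg => n; exists n.+1 => // y /= xy; rewrite xy.
by move=> /(_ _ xA)[K _ KA]; exists K.
Qed.

Lemma cantor_continuousP (f : cantor_space -> cantor_space) :
  continuous f <->
  forall (x : cantor_space) J, exists K, forall y,
    agree K x y -> agree J (f x) (f y).
Proof.
split=> [cf x J|h x A /nbhs_agreeP[J JA]].
  by apply/nbhs_agreeP/cf/nbhs_agreeP; exists J.
have [K KP] := h x J.
by apply/nbhs_agreeP; exists K => y /KP/JA.
Qed.

(** A Lebesgue number argument. If no depth works, choose pairs [u K] agreeing to depth [K] and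
    violating [E]; their first components cluster at some [x], which contradicts the local
    hypothesis at [x]. *)
Lemma cantor_uniform (E : cantor_space -> cantor_space -> Prop) :
  (forall x : cantor_space, exists K, forall y z,
    agree K x y -> agree K x z -> E y z) ->
  exists K, forall y z, agree K y z -> E y z.
Proof.
move=> loc; apply: contrapT => nE.
have /choice[u uP] : forall K, exists u : cantor_space * cantor_space,
    agree K u.1 u.2 /\ ~ E u.1 u.2.
  move=> K; apply: contrapT => h; apply: nE; exists K => y z yz.
  by apply: contrapT => nEyz; apply: h; exists (y, z).
have := @cantor_space_compact ((fun n => (u n).1) @ \oo).
move=> /(_ _ filterT)[x [_ clx]].
have [K KP] := loc x.
have xK : nbhs x [set y | agree K x y] by apply/nbhs_agreeP; exists K.
have : ((u n).1 @[n --> \oo]) [set y | exists2 n, (K <= n)%N & y = (u n).1].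
  by exists K => // n /= Kn; exists n.
move=> /clx/(_ xK)[_ [[n Kn ->] xu]].
have [uu] := uP n; apply; apply: KP => //.
by apply: agree_trans xu (agree_le Kn uu).
Qed.

Lemma clopen_uniform (A : set cantor_space) : clopen A ->
  exists K, forall y z, agree K y z -> A y -> A z.
Proof.
move=> [oA cA]; apply: cantor_uniform => x.
have [Ax|nAx] := pselect (A x).
  have /nbhs_agreeP[K KA] : nbhs x A by exact: open_nbhs_nbhs.
  by exists K => y z _ /KA.
have /nbhs_agreeP[K KA] : nbhs x (~` A).
  by apply: open_nbhs_nbhs; split => //; exact: closed_openC.
by exists K => y z /KA.
Qed.

Lemma uniform_clopen (A : set cantor_space) K :
  (forall y z, agree K y z -> A y -> A z) -> clopen A.
Proof.
move=> KA; split; last rewrite -openC.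
  rewrite openE => x Ax; apply/nbhs_agreeP; exists K => y xy; exact: KA Ax.
rewrite openE => x nAx; apply/nbhs_agreeP; exists K => y xy Ay; apply: nAx.
exact: KA (agree_sym xy) Ay.
Qed.

Lemma continuous_uniform (f : cantor_space -> cantor_space) : continuous f ->
  forall J, exists K, forall y z, agree K y z -> agree J (f y) (f z).
Proof.
move=> /cantor_continuousP cf J; apply: cantor_uniform => x.
have [K KP] := cf x J; exists K => y z /KP xy /KP; exact/agree_trans/agree_sym.
Qed.

Definition agree_dense (p : nat -> cantor_space) :=
  forall y K, exists n, agree K y (p n).

Lemma eq_on_dense (f g : cantor_space -> cantor_space) (p : nat -> cantor_space) :
  continuous f -> continuous g -> agree_dense p ->
  (forall n, f (p n) = g (p n)) -> f =1 g.
Proof.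
move=> /cantor_continuousP cf /cantor_continuousP cg dp fg x.
apply: agree_eq => J; have [K KP] := cf x J; have [L LP] := cg x J.
have [n xn] := dp x (maxn K L).
apply: (agree_trans (KP _ (agree_le (leq_maxl _ _) xn))).
by rewrite fg; apply/agree_sym/LP/(agree_le (leq_maxr _ _) xn).
Qed.

(** Uniform continuity of the correspondence [p n |-> q n]; in particular equal terms of [p] give
    equal terms of [q]. *)
Definition modulates (p q : nat -> cantor_space) :=
  forall J, exists K, forall n m, agree K (p n) (p m) -> agree J (q n) (q m).

Lemma modulates_trans q p r : modulates p q -> modulates q r -> modulates p r.
Proof.
move=> pq qr J; have [K KP] := qr J; have [L LP] := pq K.
by exists L => n m /LP/KP.
Qed.

(** Digit [j] of the image of [z] is read off [q] at an index where [p] approximates [z] to the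
    modulus of [j.+1]; the modulus makes the choice of index irrelevant. *)
Lemma extend_modulated (p q : nat -> cantor_space) :
  agree_dense p -> modulates p q ->
  exists2 F : cantor_space -> cantor_space, continuous F & forall n, F (p n) = q n.
Proof.
move=> dp /choice[K KP].
have /choice[N NP] : forall z : cantor_space * nat,
    exists n, agree (K z.2.+1) z.1 (p n).
  by move=> z; exact: dp.
pose F (z : cantor_space) : cantor_space := fun j => q (N (z, j)) j.
exists F.
  apply/cantor_continuousP => x J.
  have [L LP] : exists L, forall i, (i < J)%N -> (K i.+1 <= L)%N.
    apply: (@common_modulus (fun i L => (K i.+1 <= L)%N)).
      by move=> ? ? ? le1 le2; exact: leq_trans le1.
    by move=> i; exists (K i.+1).
  exists L => y xy i iJ; apply: (KP i.+1) => //.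
  apply: agree_trans (agree_sym (NP (x, i))) _.
  by apply: agree_trans (NP (y, i)); apply: agree_le xy; exact: LP.
move=> n; apply/funext => j; apply: (KP j.+1) => //; exact/agree_sym/(NP (_, _)).
Qed.

(** These are the hitting sets of clopen sets along [p], expressed without mentioning the clopen
    set. *)
Definition trace (p : nat -> cantor_space) : set (nat -> bool) :=
  [set D | exists K, forall n m, agree K (p n) (p m) -> D n = D m].

Lemma modulates_coord (p q : nat -> cantor_space) :
  (forall k, exists K, forall n m, agree K (p n) (p m) -> q n k = q m k) ->
  modulates p q.
Proof.
move=> h J; have [i K L KL hK n m /(agree_le KL)/hK//|//|K KP] := @common_modulus
    (fun i K => forall n m, agree K (p n) (p m) -> q n i = q m i) _ _ J.
by exists K => n m nm i iJ; exact: KP.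
Qed.

(** For the converse, each digit of [q n], as a function of [n], itself belongs to [trace q]. *)
Lemma modulates_trace p q : modulates p q <-> trace q `<=` trace p.
Proof.
split=> [pq D [J JD]|sub].
  by have [K KP] := pq J; exists K => n m /KP/JD.
by apply: modulates_coord => k; apply: (sub (q^~ k)); exists k.+1 => n m; exact.
Qed.

Definition orbit_seq (phi : cantor_space -> cantor_space) x n := iter n phi x.

(** The closure of the forward orbit is closed, non-empty and forward invariant, which is all that
    [minimal] asks for. *)
Lemma minimal_dense phi x : homeomorphism phi -> minimal phi ->
  agree_dense (orbit_seq phi x).
Proof.
move=> [cphi _] mphi y K.
have [] := mphi (closure (range (orbit_seq phi x))).
- exact: closed_closure.
- move=> _ [z clz <-] B /cphi/clz[_ [[n _ <-] Bn]].
  by exists (orbit_seq phi x n.+1); split => //; exists n.+1.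
- move/seteqP => -[] /(_ x) + _ => h; exfalso; apply/h/subset_closure.
  by exists 0%N.
move/seteqP => -[_ /(_ y I)].
move=> /(_ [set z | agree K y z])[|_ [[n _ <-] yn]]; last by exists n.
by apply/nbhs_agreeP; exists K.
Qed.

Lemma conjugate_trace_sub phi x psi y :
  pointed_conjugate phi x psi y ->
  trace (orbit_seq psi y) `<=` trace (orbit_seq phi x).
Proof.
move=> [pi [[cpi _] pi_comm pix]]; apply/modulates_trace => J.
have [K KP] := continuous_uniform cpi J.
have piE n : pi (orbit_seq phi x n) = orbit_seq psi y n.
  by elim: n => //= n IH; rewrite pi_comm IH.
by exists K => n m /KP; rewrite !piE.
Qed.

Lemma pointed_conjugate_sym (T U : topologicalType)
    (phi : T -> T) x (psi : U -> U) y :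
  pointed_conjugate phi x psi y -> pointed_conjugate psi y phi x.
Proof.
move=> [pi [[cpi [g [cg piK gK]]] pi_comm pix]]; exists g; split.
- by split=> //; exists pi.
- by move=> z; rewrite -{1}(gK z) -pi_comm piK.
- by rewrite -pix piK.
Qed.

(** Equal traces mean that the two orbits modulate each other, so both correspondences between them
    extend continuously. That the extensions are mutually inverse and intertwine the maps is checked
    on the dense orbits. *)
Lemma conjugate_trace phi x psi y :
  homeomorphism phi -> minimal phi -> homeomorphism psi -> minimal psi ->
  pointed_conjugate phi x psi y <->
  trace (orbit_seq phi x) = trace (orbit_seq psi y).
Proof.
move=> hphi mphi hpsi mpsi; split=> [c|E].
  apply/seteqP; split; apply: conjugate_trace_sub => //.
  exact: pointed_conjugate_sym.
have dp := minimal_dense x hphi mphi; have dq := minimal_dense y hpsi mpsi.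
have [F cF FE] : exists2 F, continuous F &
    forall n, F (orbit_seq phi x n) = orbit_seq psi y n.
  by apply: extend_modulated => //; apply/modulates_trace; rewrite E.
have [G cG GE] : exists2 G, continuous G &
    forall n, G (orbit_seq psi y n) = orbit_seq phi x n.
  by apply: extend_modulated => //; apply/modulates_trace; rewrite E.
have cc (f g : cantor_space -> cantor_space) :
  continuous f -> continuous g -> continuous (f \o g).
  by move=> cf cg z; apply: continuous_comp; [exact: cg|exact: cf].
have cid : continuous (@id cantor_space) by move=> z; exact: cvg_id.
exists F; split; last exact: (FE 0%N).
  split=> //; exists G; split=> //.
    by apply: (eq_on_dense (cc _ _ cG cF) cid dp) => n /=; rewrite FE GE.
  by apply: (eq_on_dense (cc _ _ cF cG) cid dq) => n /=; rewrite GE FE.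
have [[cphi _] [cpsi _]] := (hphi, hpsi).
apply: (eq_on_dense (cc _ _ cF cphi) (cc _ _ cpsi cF) dp) => n /=.
by rewrite FE -[phi _]/(orbit_seq phi x n.+1) FE.
Qed.

Definition toeplitz (p : nat -> cantor_space) :=
  forall n J, exists2 t, (0 < t)%N & forall k, agree J (p n) (p (n + k * t)%N).

(** The two moduli extend [p n |-> p n.+1] and its inverse to the whole space. Minimality comes from
    recurrence: each prefix of a term reappears with bounded gaps, so every point visits every
    cylinder. *)
Lemma toeplitz_realize (p : nat -> cantor_space) :
  agree_dense p -> toeplitz p ->
  modulates p (fun n => p n.+1) -> modulates (fun n => p n.+1) p ->
  exists phi, [/\ homeomorphism phi, minimal phi &
    forall n, orbit_seq phi (p 0%N) n = p n].
Proof.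
move=> dp tp fw bw.
(* Recurrence times are positive, so every prefix of a term also occurs at a positive index. *)
have dpS : agree_dense (fun n => p n.+1).
  move=> y K; have [n yn] := dp y K; have [[//|t] _ tP] := tp n K.
  exists (n + t)%N; apply: agree_trans yn _.
  by have := tP 1%N; rewrite mul1n addnS.
have [F cF FE] := extend_modulated dp fw.
have [G cG GE] := extend_modulated dpS bw.
have cc (f g : cantor_space -> cantor_space) :
  continuous f -> continuous g -> continuous (f \o g).
  by move=> cf cg z; apply: continuous_comp; [exact: cg|exact: cf].
have cid : continuous (@id cantor_space) by move=> z; exact: cvg_id.
have Fp i n : iter i F (p n) = p (i + n)%N by elim: i => //= i ->; rewrite FE.
exists F; split; last by move=> n; rewrite /orbit_seq Fp addn0.
  split=> //; exists G; split=> //.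
    by apply: (eq_on_dense (cc _ _ cG cF) cid dp) => n /=; rewrite FE GE.
  by apply: (eq_on_dense (cc _ _ cF cG) cid dpS) => n /=; rewrite GE FE.
move=> C cC FC; have [->|/set0P[z Cz]] := eqVneq C set0; first by left.
right; apply/seteqP; split=> // y _.
rewrite (closure_id C).1// => B /nbhs_agreeP[K KB].
have [m ym] := dp y K; have [t t0 tP] := tp m K.
have cFi i : continuous (iter i F) by elim: i => // i IH; exact: cc.
have [K' K'P] : exists K', forall i, (i < (m + t).+1)%N ->
    forall y', agree K' z y' -> agree K (iter i F z) (iter i F y').
  apply: common_modulus => [i k l kl h y' /(agree_le kl)/h//|i].
  by have /cantor_continuousP := cFi i; exact.
have [n zn] := dp z K'.
(* [j * t] is a multiple of [t] beyond [n] by at most [t], so the recurrence of [p m] at [m + j * t]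
   is reached from [p n] in [i <= m + t] steps. This bound does not involve [n], so [K'] could be
   fixed before [n]. *)
pose j := (n %/ t).+1; pose i := (m + j * t - n)%N.
have nj : (n <= j * t)%N by rewrite ltnW// ltn_ceil.
have ij : (i + n = m + j * t)%N by rewrite subnK// (leq_trans nj)// leq_addl.
have it : (i < (m + t).+1)%N.
  rewrite ltnS leq_subLR mulSn (addnCA n) leq_add2l addnC leq_add2r.
  exact: leq_trunc_div.
exists (iter i F z); split.
  by elim: (i) => //= i' IH; apply: FC; exists (iter i' F z).
apply/KB/(agree_trans ym)/(agree_trans (tP j)).
by rewrite -ij -Fp; apply/agree_sym/K'P.
Qed.

(** * Measurability in countable products *)

Lemma measurable_exists d (T : measurableType d) (I : countType)
    (P : I -> T -> Prop) :
  (forall i, measurable [set s | P i s]) -> measurable [set s | exists i, P i s].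
Proof.
move=> mP; rewrite (_ : [set s | _] =
  \bigcup_n [set s | if unpickle n is Some i then P i s else False]).
  apply: bigcupT_measurable => n.
  by case: (unpickle n) => [i|]; [exact: mP|exact: measurable0].
apply/seteqP; split=> s /=.
  by move=> [i Ps]; exists (pickle i) => //=; rewrite pickleK.
by move=> [n _ /=]; case: (unpickle n) => // i; exists i.
Qed.

Lemma measurable_neg d (T : measurableType d) (P : T -> Prop) :
  measurable [set s | P s] -> measurable [set s | ~ P s].
Proof. exact: measurableC. Qed.

Lemma measurable_forall d (T : measurableType d) (I : countType)
    (P : I -> T -> Prop) :
  (forall i, measurable [set s | P i s]) -> measurable [set s | forall i, P i s].
Proof.
move=> mP; rewrite (_ : [set s | _] = [set s | ~ exists i, ~ P i s]).
  by apply/measurable_neg/measurable_exists => i; exact/measurable_neg.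
apply/seteqP; split=> s /= => [h [i nP]|/forallNP h i].
  exact: nP (h i).
exact: contrapT (h i).
Qed.

Lemma measurable_conj d (T : measurableType d) (P Q : T -> Prop) :
  measurable [set s | P s] -> measurable [set s | Q s] ->
  measurable [set s | P s /\ Q s].
Proof. exact: measurableI. Qed.

Lemma measurable_imply d (T : measurableType d) (P Q : T -> Prop) :
  measurable [set s | P s] -> measurable [set s | Q s] ->
  measurable [set s | P s -> Q s].
Proof.
move=> mP mQ; rewrite (_ : [set s | _] = [set s | ~ (P s /\ ~ Q s)]).
  by apply/measurable_neg/measurable_conj => //; exact: measurable_neg.
apply/seteqP; split=> s /= => [h [/h]//|h Ps].
by apply: contrapT => nQ; exact: h.
Qed.

Lemma measurable_iff d (T : measurableType d) (P Q : T -> Prop) :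
  measurable [set s | P s] -> measurable [set s | Q s] ->
  measurable [set s | P s <-> Q s].
Proof.
by move=> mP mQ; apply: measurable_conj; exact: measurable_imply.
Qed.

Lemma measurable_prop d (T : measurableType d) (P : Prop) :
  measurable [set _ : T | P].
Proof.
have [p|np] := pselect P.
  by rewrite (_ : [set _ | _] = setT)//; apply/seteqP; split.
by rewrite (_ : [set _ | _] = set0)//; apply/seteqP; split.
Qed.

(** Every point of [U] lies in a box that constrains finitely many coordinates and is contained in
    [U]. Boxes are coded by lists of pairs of indices, so the preimage of [U] is a countable
    union. *)
Lemma measurable_prod_topology d (X : measurableType d) (I : Type)
    (V : topologicalType) (e : nat -> I) (B : nat -> set V)
    (f : X -> prod_topology (fun _ : I => V)) :
  (forall i, exists k, e k = i) ->
  (forall x (A : set V), nbhs x A -> exists l, B l x /\ B l `<=` A) ->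
  (forall k l, measurable [set s | B l (f s (e k))]) ->
  forall U, open U -> measurable (f @^-1` U).
Proof.
move=> esurj base mf U oU.
pose box (L : seq (nat * nat)) := [set z : prod_topology (fun _ : I => V) |
  forall c, c \in L -> B c.2 (z (e c.1))].
rewrite (_ : f @^-1` U = [set s | exists L, box L `<=` U /\ box L (f s)]).
  apply: measurable_exists => L; apply: measurable_conj.
    exact: measurable_prop.
  apply: measurable_forall => c; apply: measurable_imply => //.
  exact: measurable_prop.
apply/seteqP; split=> s /= => [Ufs|[L [LU]]]; last exact: LU.
pose F := filter_from [set L | box L (f s)] box.
have FF : Filter F.
  apply: filter_from_filter; first by exists [::].
  move=> L M Ls Ms; exists (L ++ M).
    by move=> c; rewrite mem_cat => /orP[/Ls|/Ms].
  by move=> z Lz; split=> c cL; apply: Lz; rewrite mem_cat cL ?orbT.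
have : F --> f s.
  apply/cvg_sup => i A; rewrite nbhsE => -[A' [[C oC <-] Cfs] sub].
  have [l [lfs lC]] := base (f s i) C (open_nbhs_nbhs (conj oC Cfs)).
  have [k ki] := esurj i; exists [:: (k, l)] => [c|z zb].
    by rewrite inE => /eqP ->; rewrite /= ki.
  by apply/sub/lC; have := zb (k, l) (mem_head _ _); rewrite /= ki.
move=> /(_ U (open_nbhs_nbhs (conj oU Ufs)))[L Lfs LU].
by exists L.
Qed.

Lemma cantor_base (x : bool) (A : set bool) : nbhs x A ->
  exists l, [set b | b = odd l] x /\ [set b | b = odd l] `<=` A.
Proof. by move=> /nbhs_singleton Ax; exists x; case: x Ax => Ax; split=> // _ ->. Qed.

Lemma measurable_to_cantor d (X : measurableType d) (f : X -> cantor_space) :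
  (forall k, measurable [set s | f s k]) ->
  measurable_fun setT (f : X -> g_sigma_algebraType (@open cantor_space)).
Proof.
move=> mf.
apply: (@measurability _ _ _ (g_sigma_algebraType (@open cantor_space)) _ _
  (@open cantor_space)).
  by [].
move=> _ [U oU <-]; rewrite setTI.
apply: (@measurable_prod_topology _ _ nat bool id (fun l => [set b | b = odd l])) => //.
- by move=> i; exists i.
- exact: cantor_base.
- move=> k l; case: (odd l).
    exact: mf.
  rewrite (_ : [set s | _] = [set s | ~ f s k]); first exact/measurable_neg.
  by apply/seteqP; split=> s /=; case: (f s k).
Qed.

Lemma measurable_to_real_seq d (X : measurableType d) (R : realType)
    (f : X -> nat -> R) :
  (forall k (q : rat), measurable [set s | (ratr q < f s k)%R]) ->
  measurable_fun setT (f : X -> real_seq R).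
Proof.
move=> mf.
apply: (@measurability _ _ _ (real_seq R) _ _
  (@open (prod_topology (fun _ : nat => R)))) => //.
move=> _ [U oU <-]; rewrite setTI.
pose B l : set R := if unpickle l is Some (q1, q2) then
  [set x | (ratr q1 < x < ratr q2)%R] else setT.
apply: (@measurable_prod_topology _ _ nat R id B) => //.
- by move=> i; exists i.
- move=> x A /nbhs_ballP[r /= r0 rA].
  have /rat_in_itvoo[q1] : (x - r < x)%R by rewrite ltrBlDr ltrDl.
  have /rat_in_itvoo[q2] : (x < x + r)%R by rewrite ltrDl.
  rewrite !in_itv /= => /andP[x2 r2] /andP[r1 x1].
  exists (pickle (q1, q2)); rewrite /B pickleK /= x1 x2; split=> // y /= /andP[y1 y2].
  by apply: rA; rewrite /ball /= ltr_distlC (lt_trans r1 y1) (lt_trans y2 r2).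
- move=> k l; rewrite /B; case: (unpickle l) => [[q1 q2]|]; last exact: measurable_prop.
  (* The upper bound is rewritten with a rational [q < q2], because the hypothesis only covers lower
     rational bounds. *)
  rewrite (_ : [set s | _] = [set s | (ratr q1 < f s k)%R /\
      exists q : rat, (q < q2)%R /\ ~ (ratr q < f s k)%R]).
    apply: measurable_conj => //; apply: measurable_exists => q.
    apply: measurable_conj; first exact: measurable_prop.
    exact: measurable_neg.
  apply/seteqP; split=> s /=.
    move=> /andP[-> /rat_in_itvoo[q]]; rewrite in_itv /= => /andP[q1' q2'].
    split=> //; exists q; split; first by rewrite -(ltr_rat R).
    by apply/negP; rewrite -leNgt ltW.
  move=> [-> [q [qq2 /negP]]]; rewrite -leNgt => fq /=.
  by apply: le_lt_trans fq _; rewrite ltr_rat.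
Qed.

(** * From pointed systems to sets of reals *)

Lemma image_set_inj T U (f : T -> U) (A B : set T) :
  injective f -> f @` A = f @` B -> A = B.
Proof.
move=> finj E; have sub C D : f @` C `<=` f @` D -> C `<=` D.
  by move=> CD x Cx; have [|y Dy /finj <-] := CD (f x); first by exists x.
by apply/seteqP; split; apply: sub; rewrite E.
Qed.

Definition ternary_sum (R : realType) (r : nat -> bool) n : R :=
  (\sum_(i < n) (r i)%:R * 3^-1 ^+ i)%R.

(** Base 3 with digits 0 and 1 keeps expansions unique, unlike base 2. *)
Definition ternary (R : realType) (r : nat -> bool) : R :=
  sup (range (ternary_sum R r)).

Lemma ternary_sumS (R : realType) (r : nat -> bool) n :
  ternary_sum R r n.+1 = (ternary_sum R r n + (r n)%:R * 3^-1 ^+ n)%R.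
Proof. by rewrite /ternary_sum big_ord_recr. Qed.

Lemma eq_ternary_sum (R : realType) r r' n : agree n r r' ->
  ternary_sum R r n = ternary_sum R r' n.
Proof. by move=> rr'; apply: eq_bigr => i _; rewrite rr'. Qed.

(** The correction term is the geometric sum obtained when all digits from [k] to [k + m - 1] are
    1. *)
Lemma ternary_sum_tail (R : realType) r k m :
  (ternary_sum R r (k + m) <=
   ternary_sum R r k + 3 / 2 * (3^-1 ^+ k - 3^-1 ^+ (k + m)))%R.
Proof.
elim: m => [|m IH]; first by rewrite addn0 subrr mulr0 addr0.
rewrite addnS ternary_sumS exprS.
have h : (0 <= 3^-1 ^+ (k + m) :> R)%R by rewrite exprn_ge0.
by case: (r _) => /=; rewrite ?(mulr1n, mulr0n, mul1r, mul0r); lra.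
Qed.

Lemma ternary_sum_ub (R : realType) r k n :
  (ternary_sum R r n <= ternary_sum R r k + 3 / 2 * 3^-1 ^+ k)%R.
Proof.
have p m : (0 <= 3^-1 ^+ m :> R)%R by rewrite exprn_ge0.
have [nk|/ltnW kn] := leqP n k; last first.
  by have := ternary_sum_tail R r k (n - k); rewrite subnKC//; have := p n; lra.
have : (ternary_sum R r n <= ternary_sum R r k)%R.
  rewrite -(subnKC nk); elim: (k - n)%N => [|m IH]; first by rewrite addn0.
  by rewrite addnS ternary_sumS (le_trans IH)// lerDl mulr_ge0.
by have := p k; lra.
Qed.

Lemma ternary_has_sup (R : realType) r : has_sup (range (ternary_sum R r)).
Proof.
split; first by exists (ternary_sum R r 0%N), 0%N.
exists (ternary_sum R r 0%N + 3 / 2 * 3^-1 ^+ 0)%R => _ [n _ <-].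
exact: ternary_sum_ub.
Qed.

Lemma ternary_sum_le (R : realType) r n : (ternary_sum R r n <= ternary R r)%R.
Proof. by apply: sup_upper_bound; [exact: ternary_has_sup|exists n]. Qed.

(** The digits of [r] after place [k] contribute at most [3/2 * 3^-(k+1)], half of the weight [3^-k]
    that [r'] has at place [k]. *)
Lemma ternary_lt (R : realType) r r' k : agree k r r' ->
  ~~ r k -> r' k -> (ternary R r < ternary R r')%R.
Proof.
move=> rr' /negbTE rk r'k; apply: lt_le_trans (ternary_sum_le R r' k.+1).
have : (ternary R r <= ternary_sum R r k.+1 + 3 / 2 * 3^-1 ^+ k.+1)%R.
  apply: ge_sup; first by exists (ternary_sum R r 0%N), 0%N.
  by move=> _ [n _ <-]; exact: ternary_sum_ub.
rewrite !ternary_sumS rk r'k (eq_ternary_sum R rr') exprS mulr0n mul0r.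
have h : (0 < 3^-1 ^+ k :> R)%R by rewrite exprn_gt0.
by rewrite mulr1n mul1r; lra.
Qed.

Lemma ternary_inj (R : realType) : injective (ternary R).
Proof.
move=> r r' E; apply: agree_eq => k; apply: contrapT => /first_disagreement.
move=> [i [_ rr']]; case ri : (r i); case r'i : (r' i) => // _.
  have := ternary_lt R (agree_sym rr').
  by rewrite r'i ri E ltxx => /(_ isT isT).
by have := ternary_lt R rr'; rewrite r'i ri E ltxx => /(_ isT isT).
Qed.

(** A supremum exceeds [a] exactly when some partial sum does, and a partial sum depends on one of
    countably many finite prefixes [t]. *)
Lemma measurable_ternary_gt d (X : measurableType d) (R : realType)
    (r : X -> nat -> bool) (a : R) :
  (forall n, measurable [set s | r s n]) ->
  measurable [set s | (a < ternary R (r s))%R].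
Proof.
move=> mr; rewrite (_ : [set s | _] = [set s | exists n, exists t : seq bool,
    (a < ternary_sum R (nth false t) n)%R /\
    forall i, (i < n)%N -> (r s i <-> nth false t i)]).
  apply: measurable_exists => n; apply: measurable_exists => t.
  apply: measurable_conj; first exact: measurable_prop.
  apply: measurable_forall => i; apply: measurable_imply.
    exact: measurable_prop.
  by apply: measurable_iff => //; exact: measurable_prop.
apply/seteqP; split=> s /=.
  move=> /(sup_gt (proj1 (ternary_has_sup R (r s))))[_ [n _ <-] an].
  exists n, (mkseq (r s) n); split; last by move=> i ni; rewrite nth_mkseq.
  by rewrite (@eq_ternary_sum _ _ (r s))// => i ni; rewrite nth_mkseq.
move=> [n [t [an tP]]]; apply: lt_le_trans (ternary_sum_le R _ n).
rewrite (@eq_ternary_sum _ _ (nth false t))// => i /tP[h h'].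
by apply/idP/idP.
Qed.

(** The codes form a countable type and reach all clopen sets, so quantifiers over clopen sets
    become countable unions and intersections. *)
Definition prefix_set (c : nat * seq (seq bool)) : set cantor_space :=
  [set z : cantor_space | mkseq z c.1 \in c.2].

Lemma mkseq_agree K y z : mkseq y K = mkseq z K <-> agree K y z.
Proof.
split=> [E i iK|yz].
  by rewrite -(nth_mkseq false y iK) E nth_mkseq.
by apply/eq_in_map => i; rewrite mem_iota => /yz.
Qed.

Lemma prefix_set_agree c y z : agree c.1 y z -> prefix_set c y -> prefix_set c z.
Proof. by move=> /mkseq_agree yz; rewrite /prefix_set /= yz. Qed.

Lemma prefix_set_clopen c :
  prefix_set c \in [set A | @clopen cantor_space A].
Proof. by rewrite inE; apply: uniform_clopen => y z; exact: prefix_set_agree. Qed.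

Definition prefix_clopen c : cantor_clopen :=
  exist _ (prefix_set c) (prefix_set_clopen c).

Lemma finite_prefixes (D : seq bool -> Prop) K : exists L : seq (seq bool),
  forall t, size t = K -> (t \in L <-> D t).
Proof.
exists [seq val t | t <- [seq t <- enum {: K.-tuple bool} | `[< D (val t) >]]].
move=> t /eqP tK; split=> [/mapP[u]|Dt].
  by rewrite mem_filter => /andP[/asboolP Du _] ->.
apply/mapP; exists (Tuple tK) => //.
by rewrite mem_filter mem_enum andbT; apply/asboolP.
Qed.

Lemma clopen_prefix_set (A : set cantor_space) : clopen A ->
  exists c, prefix_set c = A.
Proof.
move=> /clopen_uniform[K KA].
have [L LP] := finite_prefixes (fun t => A (nth false t)) K.
exists (K, L); apply/seteqP; split=> z /=.
  rewrite /prefix_set /= LP ?size_mkseq//.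
  by apply: KA => i iK; rewrite nth_mkseq.
move=> Az; rewrite /prefix_set /= LP ?size_mkseq//.
by apply: KA Az => i iK; rewrite nth_mkseq.
Qed.

Lemma prefix_clopen_surj (A : cantor_clopen) : exists c, prefix_clopen c = A.
Proof.
have [c cA] := clopen_prefix_set (set_valP A).
by exists c; exact: val_inj.
Qed.

Definition prefix_hits (p : nat -> cantor_space) (c : nat * seq (seq bool)) n : bool :=
  mkseq (p n) c.1 \in c.2.

Lemma trace_prefix_hits p : trace p = range (prefix_hits p).
Proof.
apply/seteqP; split=> [D [K KD]|_ [c _ <-]]; last first.
  by exists c.1 => n m /mkseq_agree; rewrite /prefix_hits => ->.
(* The clopen set collects the prefixes that [p] takes at the indices in [D]. *)
have [L LP] := finite_prefixes (fun t => exists2 n, mkseq (p n) K = t & D n) K.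
exists (K, L) => //; apply/funext => n; apply/idP/idP.
  rewrite /prefix_hits /= LP ?size_mkseq// => -[m /mkseq_agree E Dm].
  by rewrite -(KD _ _ E).
by move=> Dn; rewrite /prefix_hits /= LP ?size_mkseq//; exists n.
Qed.

Lemma minimal_homeoP (phi : cantor_minimal_homeo) :
  homeomorphism (set_val phi) /\ minimal (set_val phi).
Proof. exact: (set_valP phi). Qed.

Lemma cantor_clopenP (A : cantor_clopen) : @clopen cantor_space (set_val A).
Proof. exact: (set_valP A). Qed.

Lemma measurable_action_eq (A B : cantor_clopen) :
  measurable [set phi : minimal_homeo_borel |
    clopen_action (phi : cantor_minimal_homeo) A = B].
Proof.
exists [set h : clopen_self_maps | h A = B]; last by rewrite setTI.
apply: sub_sigma_algebra.
apply: (@open_comp clopen_self_maps (discrete_topology cantor_clopen)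
  (fun h => h A) [set B]); last exact: discrete_open.
move=> h _; exact: (@proj_continuous _
  (fun _ : cantor_clopen => discrete_topology cantor_clopen) A h).
Qed.

Lemma clopen_actionE (phi : cantor_minimal_homeo) (A B : cantor_clopen) :
  clopen_action phi A = B <->
  forall z, set_val A z <-> set_val B (set_val phi z).
Proof.
have [[_ [g [_ phiK gK]]] _] := minimal_homeoP phi.
split=> [<- z /=|AB].
  split=> [Az|[y Ay /(can_inj phiK) <-//]]; by exists z.
apply: val_inj; apply/seteqP; split=> [_ [z Az <-]|z Bz]; first exact/AB.
by exists (g z); [apply/AB|]; rewrite gK.
Qed.

Definition system_orbit (s : pointed_minimal_system) : nat -> cantor_space :=
  orbit_seq (set_val (s.1 : cantor_minimal_homeo)) s.2.

(** Induction for all [A] at once: the next orbit point is in [A] when the current one is in the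
    preimage of [A]. That preimage is one of the countably many coded clopen sets, recognised by the
    measurable condition that its image is [A]. *)
Lemma measurable_orbit_clopen (A : cantor_clopen) n :
  measurable [set s | set_val A (system_orbit s n)].
Proof.
elim: n A => [|n IH] A.
  rewrite -[X in measurable X]setTI; apply: measurable_snd => //.
  apply: sub_sigma_algebra; exact: (proj1 (cantor_clopenP A)).
rewrite (_ : [set s | _] = [set s | exists c,
    clopen_action (s.1 : cantor_minimal_homeo) (prefix_clopen c) = A /\
    set_val (prefix_clopen c) (system_orbit s n)]).
  apply: measurable_exists => c; apply: measurable_conj => //.
  rewrite -[X in measurable X]setTI.
  exact: (@measurable_fst _ _ minimal_homeo_borel
    (g_sigma_algebraType (@open cantor_space)) measurableT _
    (measurable_action_eq (prefix_clopen c) A)).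
apply/seteqP; split=> s /=; last first.
  by move=> [c [/clopen_actionE cA /cA]].
move=> As; set phi := (s.1 : cantor_minimal_homeo).
have [[cphi _] _] := minimal_homeoP phi.
have cB : clopen (set_val phi @^-1` set_val A).
  have [oA cA] := cantor_clopenP A.
  by split; [apply: open_comp|apply: closed_comp] => // ? _; exact: cphi.
have [c cE] := clopen_prefix_set cB.
have {}cE : set_val (prefix_clopen c) = set_val phi @^-1` set_val A := cE.
exists c; split; last by rewrite cE.
by apply/clopen_actionE => z; rewrite cE.
Qed.

Definition trace_code (R : realType) (s : pointed_minimal_system) (k : nat) : R :=
  ternary R (fun n =>
    if unpickle k is Some c then prefix_hits (system_orbit s) c n else false).

Lemma range_trace_code (R : realType) s :
  range (trace_code R s) = ternary R @` trace (system_orbit s).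
Proof.
rewrite trace_prefix_hits; apply/seteqP; split=> [_ [k _ <-]|_ [_ [c _ <-] <-]].
  rewrite /trace_code; case: (unpickle k) => [c|].
    by exists (prefix_hits (system_orbit s) c).
  (* Indices that code nothing yield the hitting set of the empty clopen set, so they add nothing to
     the range. *)
  by exists (prefix_hits (system_orbit s) (0%N, [::])).
by exists (pickle c) => //; rewrite /trace_code pickleK.
Qed.

Lemma conjugacy_trace s t :
  pointed_conjugacy s t <-> trace (system_orbit s) = trace (system_orbit t).
Proof.
have [hs ms] := minimal_homeoP s.1.
have [ht mt] := minimal_homeoP t.1.
exact: conjugate_trace.
Qed.

Lemma conjugacy_reducible_Delta_plus (R : realType) :
  @borel_reducible _ _ pointed_minimal_system (real_seq R)
    pointed_conjugacy (@Delta_plus R).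
Proof.
exists (trace_code R : pointed_minimal_system -> real_seq R).
  apply: measurable_to_real_seq => k q; apply: measurable_ternary_gt => n.
  case: (unpickle k) => [c|]; last exact: measurable_prop.
  exact: (measurable_orbit_clopen (prefix_clopen c)).
move=> s t; rewrite conjugacy_trace /Delta_plus !range_trace_code.
by split=> [->//|/(image_set_inj (@ternary_inj R))].
Qed.

(** * Splitting levels *)

(** In the tree of prefixes of the terms of [w], the node of length [k] on the branch of [w n] has
    two children. *)
Definition splits (w : nat -> cantor_space) n k :=
  exists m, agree k (w n) (w m) /\ w m k <> w n k.

Definition split_count w n k := (\sum_(i < k) `[< splits w n i >])%N.

(** Forced digits are dropped. The existential acts as a description: [split_count] strictly
    increases along splitting levels, so at most one [k] qualifies. *)
Definition split_seq (w : nat -> cantor_space) n : cantor_space := fun j =>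
  `[< exists k, [/\ splits w n k, split_count w n k = j & w n k] >].

Lemma splits_agree w n m k : agree k (w n) (w m) -> splits w n k -> splits w m k.
Proof.
move=> nm [l [nl lk]].
have [mk|mk] := pselect (w m k = w n k); last first.
  by exists n; split; [exact: agree_sym|move=> /esym].
by exists l; rewrite mk; split=> //; apply: agree_trans nl; exact: agree_sym.
Qed.

Lemma split_count_agree w n m k : agree k (w n) (w m) ->
  split_count w n k = split_count w m k.
Proof.
move=> nm; apply: eq_bigr => i _; congr nat_of_bool.
have nmi : agree i (w n) (w m) by apply: agree_le nm; exact/ltnW.
by apply/asboolP/asboolP; apply: splits_agree => //; exact: agree_sym.
Qed.

Lemma split_countS w n k :
  split_count w n k.+1 = (split_count w n k + `[< splits w n k >])%N.
Proof. by rewrite /split_count big_ord_recr. Qed.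

Lemma leq_split_count w n k l : (k <= l)%N ->
  (split_count w n k <= split_count w n l)%N.
Proof.
move=> kl; rewrite -(subnKC kl); elim: (l - k)%N => [|d IH]; first by rewrite addn0.
by rewrite addnS split_countS (leq_trans IH)// leq_addr.
Qed.

Lemma split_count_lt w n k l : (k < l)%N -> splits w n k ->
  (split_count w n k < split_count w n l)%N.
Proof.
move=> kl nk; apply: leq_trans (leq_split_count w n kl).
by rewrite split_countS asboolT// addn1.
Qed.

Lemma split_count_le w n k : (split_count w n k <= k)%N.
Proof.
elim: k => [|k IH]; first by rewrite /split_count big_ord0.
by rewrite split_countS -addn1 leq_add// leq_b1.
Qed.

Lemma split_seqE w n k : splits w n k -> split_seq w n (split_count w n k) = w n k.
Proof.
move=> nk; apply/asboolP/idP => [[l [nl lk]]|wnk]; last by exists k.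
by case: (ltngtP k l) => [|/[dup] kl|->//] /split_count_lt => [/(_ _ _ nk)|/(_ _ _ nl)];
  rewrite lk ltnn.
Qed.

(** The first place where [w n] and [w m] differ is a splitting level of both, with the same count,
    and so gives a difference of the kept digits before [J]. *)
Lemma split_seq_agree w n m J k : agree J (split_seq w n) (split_seq w m) ->
  (split_count w n k <= J)%N -> agree k (w n) (w m).
Proof.
move=> nm kJ; apply: contrapT => /first_disagreement[i [ik wi /eqP ni]].
have si : splits w n i by exists m; split=> // /esym.
have si' : splits w m i by exact: splits_agree si.
apply: ni; rewrite -split_seqE// -(split_seqE si') -(split_count_agree wi).
by apply: nm; apply: leq_trans kJ; exact: split_count_lt.
Qed.

Lemma split_seq_modulates w : modulates (split_seq w) w.
Proof.
move=> J; exists J => n m /split_seq_agree; apply; exact: split_count_le.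
Qed.

Definition perfect_seq (w : nat -> cantor_space) :=
  forall n k, exists m, agree k (w n) (w m) /\ w n <> w m.

Lemma split_level w n j : perfect_seq w ->
  exists2 k, splits w n k & split_count w n k = j.
Proof.
move=> pw; have [K] : exists K, (j < split_count w n K)%N.
  elim: j.+1 => [|i [K iK]]; first by exists 0%N.
  have [m [Km nm]] := pw n K.
  have [L /first_disagreement[k [_ wk /eqP nk]]] : exists L, ~ agree L (w n) (w m).
    by apply/existsNP => /agree_eq.
  exists k.+1; apply: leq_ltn_trans iK _.
  apply: leq_ltn_trans (leq_split_count w n (_ : K <= k)%N) _.
    by rewrite leqNgt; apply/negP => /Km.
  by apply: split_count_lt => //; exists m; split=> // /esym.
(* The count starts at 0 and grows by at most one per level, so it leaves the value [j] at a
   splitting level. *)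
elim: K => [|K IH]; first by rewrite /split_count big_ord0.
have [/IH//|Kj] := ltnP j (split_count w n K).
rewrite split_countS; case: asboolP => nK; last first.
  by rewrite addn0 ltnNge Kj.
by rewrite addn1 ltnS => jK; exists K => //; apply/eqP; rewrite eqn_leq Kj.
Qed.

(** The level of splitting number [j] is determined by the [j] kept digits before it. There are
    finitely many such tuples, so these levels have a maximum; tuples that do not occur get level
    0. *)
Lemma modulates_split_seq w : perfect_seq w -> modulates w (split_seq w).
Proof.
move=> pw; apply: modulates_coord => j.
have /choice[l lP] : forall t : j.-tuple bool, exists k, forall n,
    agree j (nth false t) (split_seq w n) ->
    splits w n k /\ split_count w n k = j.
  move=> t; have [[n0 n0t]|nex] := pselect (exists n,
      agree j (nth false t) (split_seq w n)); last first.
    by exists 0%N => n nt; exfalso; apply: nex; exists n.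
  have [k n0k kj] := split_level n0 j pw; exists k => n nt.
  have nn0 : agree k (w n0) (w n).
    apply: (@split_seq_agree _ _ _ j); last by rewrite kj.
    by apply: agree_trans nt; exact: agree_sym.
  by split; [exact: splits_agree n0k|rewrite -(split_count_agree nn0)].
exists (\max_(t : j.-tuple bool) (l t).+1)%N => n m nm.
pose t : j.-tuple bool := mktuple (fun i : 'I_j => split_seq w n i).
have [|nk kj] := lP t n.
  by move=> i ij; rewrite -[i]/(nat_of_ord (Ordinal ij)) -tnth_nth tnth_mktuple.
have lt : (l t < \max_(t : j.-tuple bool) (l t).+1)%N by exact: leq_bigmax.
have {}nm' : agree (l t) (w n) (w m) by exact: agree_le (ltnW lt) nm.
rewrite -{1}kj split_seqE// -kj (split_count_agree nm') split_seqE.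
  exact: nm.
exact: splits_agree nk.
Qed.

(** If the kept digit [J] is wrong, the witness of the splitting has the opposite digit there and
    the same earlier ones. *)
Lemma split_seq_dense w : perfect_seq w -> agree_dense (split_seq w).
Proof.
move=> pw y; elim=> [|J [n yn]]; first by exists 0%N.
have [k nk kJ] := split_level n J pw.
have [wk|wk] := pselect (w n k = y J).
  by exists n; apply/agreeS; split=> //; rewrite -{2}kJ split_seqE.
have [m [nm mk]] := nk; exists m; apply/agreeS; split; last first.
  rewrite -{2}kJ (split_count_agree nm) split_seqE; last exact: splits_agree nk.
  by move: wk mk; case: (y J); case: (w n k); case: (w m k).
move=> i iJ; rewrite yn//.
have [k' nk' k'i] := split_level n i pw.
have kk' : (k' < k)%N.
  by rewrite ltnNge; apply/negP => /(leq_split_count w n); rewrite kJ k'i leqNgt iJ.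
have nm' := agree_le (ltnW kk') nm.
rewrite -{1}k'i split_seqE// -k'i (split_count_agree nm') split_seqE.
  exact: nm.
exact: splits_agree nk'.
Qed.

Lemma split_seq_trace w : perfect_seq w -> trace (split_seq w) = trace w.
Proof.
move=> pw; apply/seteqP; split; apply/modulates_trace.
  exact: modulates_split_seq.
exact: split_seq_modulates.
Qed.

Lemma split_seq_realize (w : nat -> cantor_space) :
  perfect_seq w -> toeplitz w ->
  modulates w (fun n => w n.+1) -> modulates (fun n => w n.+1) w ->
  exists phi, [/\ homeomorphism phi, minimal phi &
    forall n, orbit_seq phi (split_seq w 0%N) n = split_seq w n].
Proof.
move=> pw tw fw bw.
have wp := modulates_split_seq pw; have pw' := @split_seq_modulates w.
apply: toeplitz_realize.
- exact: split_seq_dense.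
- move=> n J; have [K KP] := wp J; have [t t0 tP] := tw n K.
  by exists t => // k; exact: KP.
- apply: (modulates_trans pw'); apply: (modulates_trans fw) => J.
  by have [K KP] := wp J; exists K => n m; exact: KP.
- apply: modulates_trans wp; apply: modulates_trans bw => J.
  by have [K KP] := pw' J; exists K => n m; exact: KP.
Qed.

Lemma measurable_eq_bool d (X : measurableType d) (f g : X -> bool) :
  measurable [set s | f s] -> measurable [set s | g s] ->
  measurable [set s | f s = g s].
Proof.
move=> mf mg; rewrite (_ : [set s | _] = [set s | f s <-> g s]).
  exact: measurable_iff.
apply/seteqP; split=> s /= => [->//|fg]; by apply/idP/idP => /fg.
Qed.

Lemma measurable_agree d (X : measurableType d) (f g : X -> nat -> bool) k :
  (forall i, measurable [set s | f s i]) ->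
  (forall i, measurable [set s | g s i]) ->
  measurable [set s | agree k (f s) (g s)].
Proof.
move=> mf mg; apply: measurable_forall => i; apply: measurable_imply.
  exact: measurable_prop.
exact: measurable_eq_bool.
Qed.

Lemma measurable_split_seq d (X : measurableType d)
    (w : X -> nat -> cantor_space) :
  (forall n k, measurable [set s | w s n k]) ->
  forall n j, measurable [set s | split_seq (w s) n j].
Proof.
move=> mw.
have msplits n k : measurable [set s | splits (w s) n k].
  apply: measurable_exists => m; apply: measurable_conj.
    exact: measurable_agree.
  by apply/measurable_neg/measurable_eq_bool.
have mcount n k j : measurable [set s | split_count (w s) n k = j].
  elim: k j => [|k IH] j.
    rewrite (_ : [set s | _] = [set _ | 0%N = j]); first exact: measurable_prop.
    by apply/seteqP; split=> s /=; rewrite /split_count big_ord0.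
  rewrite (_ : [set s | _] = [set s | exists i, split_count (w s) n k = i /\
      ((splits (w s) n k -> i.+1 = j) /\ (~ splits (w s) n k -> i = j))]).
    apply: measurable_exists => i; apply: measurable_conj => //.
    apply: measurable_conj; apply: measurable_imply; do ?exact: measurable_prop.
      exact: msplits.
    exact/measurable_neg/msplits.
  apply/seteqP; split=> s /=; rewrite split_countS; case: asboolP => sk.
  - by rewrite addn1 => <-; exists (split_count (w s) n k).
  - by rewrite addn0 => <-; exists (split_count (w s) n k).
  - by move=> [i [-> [/(_ sk) <- _]]]; rewrite addn1.
  - by move=> [i [-> [_ /(_ sk) <-]]]; rewrite addn0.
move=> n j; rewrite (_ : [set s | _] = [set s | exists k, splits (w s) n k /\
    (split_count (w s) n k = j /\ w s n k)]).
  by apply: measurable_exists => k; do 2 apply: measurable_conj => //.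
apply/seteqP; split=> s /=; first by move=> /asboolP[k [? ? ?]]; exists k.
by move=> [k [? [? ?]]]; apply/asboolP; exists k.
Qed.

(** * From sets of reals to pointed systems *)

Lemma agree_odometer k x y : agree k (odometer x) (odometer y) <-> agree k x y.
Proof.
(* [f] is the identity for the odometer and the negation for its inverse; neither looks ahead, so
   the odometer preserves the length of common prefixes. *)
have causal (f : bool -> bool) (u v : cantor_space) : agree k u v ->
    agree k (fun n => u n (+) all (f \o u) (iota 0 n))
            (fun n => v n (+) all (f \o v) (iota 0 n)).
  move=> uv i ik; rewrite uv//; congr (_ (+) _); apply: eq_in_all => j.
  by rewrite mem_iota /= => ji; rewrite uv//; exact: ltn_trans ik.
split; last exact: (causal id).
move=> /(causal negb); rewrite -[X in agree _ X]/(odometer_inv (odometer x)).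
by rewrite -[X in agree _ _ X]/(odometer_inv (odometer y)) !odometerK.
Qed.

Lemma agree_iter_odometer k a x y :
  agree k (iter a odometer x) (iter a odometer y) <-> agree k x y.
Proof. by elim: a => //= a IH; rewrite agree_odometer. Qed.

Lemma odometer_period t k x : agree t (iter (k * 2 ^ t) odometer x) x.
Proof.
elim: k => [|k IH]; first by rewrite mul0n.
rewrite mulSn iterD; apply: agree_trans IH => i it.
by rewrite iter_odometer /odometer_shift leqNgt it addbF.
Qed.

Lemma odometer_carry t x : iter (2 ^ t) odometer x t = ~~ x t.
Proof. by rewrite iter_odometer /odometer_shift leqnn subnn /= addbT. Qed.

(** When [z = b] there is no such [k], and the value defaults to [false]. *)
Definition diff_parity (z b : nat -> bool) : bool :=
  `[< exists k, [/\ odd k, agree k z b & ~ agree k.+1 z b] >].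

Lemma diff_parity_odometer z b :
  diff_parity (odometer z) (odometer b) = diff_parity z b.
Proof.
apply/asboolP/asboolP => -[k [ok zb nzb]]; exists k; split=> //.
- exact/agree_odometer.
- by move/agree_odometer.
- exact/agree_odometer.
- by move/agree_odometer.
Qed.

Lemma diff_parityE k z b : agree k z b -> z k <> b k -> diff_parity z b = odd k.
Proof.
move=> zb zbk; apply/asboolP/idP => [[l [ol zl nzl]]|ok]; last first.
  by exists k; split=> // /agreeS[].
have [kl|lk|->//] := ltngtP k l.
  by case: zbk; exact: zl.
by case: nzl; exact: agree_le zb.
Qed.

Lemma diff_parity_local z b : z <> b ->
  exists K, forall y, agree K z y -> diff_parity y b = diff_parity z b.
Proof.
move=> zb; have [L /first_disagreement[k [_ zbk /eqP nk]]] :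
    exists L, ~ agree L z b.
  by apply/existsNP => /agree_eq.
exists k.+1 => y /agreeS[zy zyk]; rewrite (diff_parityE zbk nk).
apply: diff_parityE; last by rewrite -zyk.
by apply: agree_trans zbk; exact: agree_sym.
Qed.

(* Every digit of [c] occurs infinitely often in [spread c]. *)
Definition spread (c : nat -> bool) : cantor_space := fun k => c (logn 2 k).

Lemma spread_digit a K : exists2 k, (K <= k)%N & forall c, spread c k = c a.
Proof.
exists (2 ^ a * 3 ^ K)%N.
  apply: leq_trans (ltnW (ltn_expl K (isT : (1 < 3)%N))) _.
  by rewrite leq_pmull// expn_gt0.
move=> c; rewrite /spread lognM ?expn_gt0// !lognX.
by rewrite (_ : logn 2 2 = 1%N)// (_ : logn 2 3 = 0%N)// muln1 muln0 addn0.
Qed.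

(** A carry stops at the first digit 0, so with infinitely many zeros each step changes only
    finitely many digits. *)
Lemma iter_odometer_tail (x : cantor_space) n :
  (forall K, exists2 k, (K <= k)%N & ~~ x k) ->
  exists K, forall k, (K <= k)%N -> iter n odometer x k = x k.
Proof.
move=> x0; elim: n => [|n [K KP]]; first by exists 0%N.
have [l Kl xl] := x0 K; exists (maxn K l.+1) => k; rewrite geq_max => /andP[Kk lk].
rewrite -(KP _ Kk) /= {1}/odometer.
rewrite (_ : all _ _ = false) ?addbF//; apply/negbTE/allPn; exists l.
  by rewrite mem_iota.
by rewrite KP.
Qed.

(** A 0 in the code gives infinitely many zeros in its spread, so iterates keep the tail; any tail
    of a spread contains every digit of the code. *)
Lemma spread_orbit_inj c c' n m : (exists a, ~~ c a) -> (exists a, ~~ c' a) ->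
  iter n odometer (spread c) = iter m odometer (spread c') -> c = c'.
Proof.
have tail e l : (exists a, ~~ e a) ->
    exists K, forall k, (K <= k)%N -> iter l odometer (spread e) k = spread e k.
  move=> [a ea]; apply: iter_odometer_tail => K.
  by have [k Kk ek] := spread_digit a K; exists k; rewrite ?ek.
move=> /(tail c n)[K KP] /(tail c' m)[L LP] E; apply/funext => a.
have [k] := spread_digit a (maxn K L); rewrite geq_max => /andP[Kk Lk] kP.
by rewrite -!kP -KP// -LP// E.
Qed.

Definition base_orbit n : cantor_space := iter n odometer (fun _ => false).

Lemma iter_base_orbitS a n :
  iter a odometer (base_orbit n.+1) = iter a.+1 odometer (base_orbit n).
Proof. by rewrite iterSr. Qed.

(** Both shifts [a] and [b] are present so that the family is closed in both time directions: the
    step from [n] to [n.+1] is absorbed by raising [a], the step back by raising [b]. *)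
Definition coding (c : nat -> nat -> bool) n : cantor_space := fun k =>
  match unpickle k : option (nat + nat * nat * nat) with
  | Some (inl j) => base_orbit n j
  | Some (inr (i, a, b)) =>
      diff_parity (iter a odometer (base_orbit n)) (iter b odometer (spread (c i)))
  | None => false
  end.

Lemma coding_digit c n j :
  coding c n (pickle (inl j : nat + nat * nat * nat)) = base_orbit n j.
Proof. by rewrite /coding pickleK. Qed.

Lemma coding_parity c n i a b :
  coding c n (pickle (inr (i, a, b) : nat + nat * nat * nat)) =
  diff_parity (iter a odometer (base_orbit n)) (iter b odometer (spread (c i))).
Proof. by rewrite /coding pickleK. Qed.

Lemma coding_modulates_base c : modulates (coding c) base_orbit.
Proof.
apply: modulates_coord => j; exists (pickle (inl j : nat + nat * nat * nat)).+1.
by move=> n m nm; rewrite -!(coding_digit c) nm.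
Qed.

Lemma coding_forward c : modulates (coding c) (fun n => coding c n.+1).
Proof.
apply: modulates_coord => k; rewrite {3 4}/coding.
case: (unpickle k) => [[j|[[i a] b]]|]; last by exists 0%N.
  have [K KP] := coding_modulates_base c j.+1; exists K => n m /KP nm.
  by have /agree_odometer := nm; apply.
exists (pickle (inr (i, a.+1, b) : nat + nat * nat * nat)).+1 => n m nm.
by rewrite !iter_base_orbitS -!coding_parity nm.
Qed.

Lemma coding_backward c : modulates (fun n => coding c n.+1) (coding c).
Proof.
apply: modulates_coord => k; rewrite {3 4}/coding.
case: (unpickle k) => [[j|[[i a] b]]|]; last by exists 0%N.
  have [K KP] := coding_modulates_base c j.+1; exists K => n m /KP.
  by move=> /agree_odometer; apply.
exists (pickle (inr (i, a, b.+1) : nat + nat * nat * nat)).+1 => n m nm.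
rewrite -diff_parity_odometer -[RHS]diff_parity_odometer -!iterS.
by rewrite -!iter_base_orbitS -!coding_parity nm.
Qed.

Definition proper_code (c : nat -> bool) := (exists a, c a) /\ (exists a, ~~ c a).

(** This keeps the base orbit away from all discontinuities of the parity functions. Equality would
    force [c] to be constantly [false]. *)
Lemma iter_odometer_neq c n m : proper_code c ->
  iter n odometer (fun _ => false) <> iter m odometer (spread c).
Proof.
move=> [[a ca] c0] E; have cE : (fun=> false) = c.
  by apply: (@spread_orbit_inj _ _ n m) => //; exists 0%N.
by rewrite -cE in ca.
Qed.

(** The first [J] coordinates are continuous at [base_orbit n], hence decided by some [t] of its
    digits, and these have period [2 ^ t]. *)
Lemma coding_locally_periodic c n J : (forall i, proper_code (c i)) ->
  exists t, forall k, agree J (coding c n) (coding c (n + k * 2 ^ t)).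
Proof.
move=> pc; have [|j|t tP] := @common_modulus
    (fun j t => forall m, agree t (base_orbit n) (base_orbit m) ->
      coding c n j = coding c m j) _ _ J.
- by move=> j K L KL h m /(agree_le KL)/h.
- rewrite /coding; case: (unpickle j) => [[d|[[i a] b]]|]; last by exists 0%N.
    by exists d.+1 => m; exact.
  have [|K KP] := @diff_parity_local
    (iter a odometer (base_orbit n)) (iter b odometer (spread (c i))).
    by rewrite -iterD; exact: iter_odometer_neq.
  by exists K => m nm; apply/esym/KP/agree_iter_odometer.
exists t => k j jJ; apply: tP => //; rewrite /base_orbit addnC iterD.
exact/agree_sym/odometer_period.
Qed.

Lemma coding_toeplitz c : (forall i, proper_code (c i)) -> toeplitz (coding c).
Proof.
move=> pc n J; have [t tP] := coding_locally_periodic n J pc.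
by exists (2 ^ t)%N; rewrite // expn_gt0.
Qed.

Lemma coding_perfect c : (forall i, proper_code (c i)) -> perfect_seq (coding c).
Proof.
move=> pc n k; have [t tP] := coding_locally_periodic n k pc.
(* Moving by [2 ^ t] preserves the prefix of the coding but flips digit [t] of the base point. *)
exists (n + 1 * 2 ^ t)%N; split; first exact: tP.
move=> /(congr1 (fun x => x (pickle (inl t : nat + nat * nat * nat)))).
rewrite !coding_digit {2}/base_orbit mul1n addnC iterD odometer_carry -/(base_orbit n).
by case: (base_orbit n t).
Qed.

Lemma coding_trace_sub c c' : range c `<=` range c' ->
  trace (coding c) `<=` trace (coding c').
Proof.
move=> cc'; apply/modulates_trace/modulates_coord => k.
rewrite {3 4}/coding; case: (unpickle k) => [[j|[[i a] b]]|]; last by exists 0%N.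
  have [K KP] := coding_modulates_base c' j.+1.
  by exists K => n m /KP; apply.
have [i' _ <-] : range c' (c i) by apply: cc'; exists i.
exists (pickle (inr (i', a, b) : nat + nat * nat * nat)).+1 => n m nm.
by rewrite -!coding_parity nm.
Qed.

(* [diff_parity _ (spread (c i))] is discontinuous at [spread (c i)], whereas
   all coordinates of [coding c'] extend continuously to that point when
   [c i] is not in the range of [c']. *)
Lemma trace_coding_sub c c' :
  (forall i, proper_code (c i)) -> (forall i, proper_code (c' i)) ->
  trace (coding c) `<=` trace (coding c') -> range c `<=` range c'.
Proof.
move=> pc pc' sub _ [i _ <-]; apply: contrapT => nci.
have [|K KP] := sub (fun n => diff_parity (base_orbit n) (spread (c i))).
  exists (pickle (inr (i, 0, 0)%N : nat + nat * nat * nat)).+1 => n m nm.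
  by have := nm _ (leqnn _); rewrite !coding_parity.
have [|j|T TP] := @common_modulus
    (fun j T => forall n m, agree T (spread (c i)) (base_orbit n) ->
      agree T (spread (c i)) (base_orbit m) -> coding c' n j = coding c' m j) _ _ K.
- by move=> j S T ST h n m /(agree_le ST) hn /(agree_le ST) hm; exact: h.
- rewrite /coding; case: (unpickle j) => [[d|[[i' a] b]]|]; last by exists 0%N.
    by exists d.+1 => n m hn hm; rewrite -hn// -hm.
  have [|T TP] := @diff_parity_local
    (iter a odometer (spread (c i))) (iter b odometer (spread (c' i'))).
    move=> /spread_orbit_inj E; apply: nci; exists i' => //; apply/esym/E.
      by have [] := pc i.
    by have [] := pc' i'.
  by exists T => n m hn hm; rewrite !TP//; exact/agree_iter_odometer.
(* The base orbit can be made to leave [spread (c i)] at any prescribed place [k], by reaching that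
   point with digit [k] flipped. *)
have hit k : (T <= k)%N -> exists n, agree T (spread (c i)) (base_orbit n) /\
    diff_parity (base_orbit n) (spread (c i)) = odd k.
  move=> Tk; have [n nP] := odometer_reach (fun _ => false)
    (fun j => spread (c i) j (+) (j == k)) k.+1.
  rewrite -/(base_orbit n) in nP.
  have nk : agree k (base_orbit n) (spread (c i)).
    by move=> j jk; rewrite (nP _ (leqW jk)) (ltn_eqF jk) addbF.
  exists n; split; first exact/agree_sym/(agree_le Tk).
  apply: diff_parityE => //; rewrite nP// eqxx addbT.
  by case: (spread _ _).
(* Two places of opposite parity beyond [T]: the coding by [c'] cannot tell the two times apart, but
   the parity does. *)
have [n [nT n1]] := hit T.*2 (leq_trans (leq_addr T T) (eq_leq (addnn T))).
have [m [mT m1]] := hit T.*2.+1 (leqW (leq_trans (leq_addr T T) (eq_leq (addnn T)))).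
have := KP n m (fun j jK => TP j jK n m nT mT).
by rewrite n1 m1 /= odd_double.
Qed.

Definition real_code (R : realType) (x : R) (k : nat) : bool :=
  if unpickle k is Some q then (ratr q < x)%R else false.

Lemma real_code_proper (R : realType) (x : R) : proper_code (real_code x).
Proof.
split.
  have /rat_in_itvoo[q] : (x - 1 < x)%R by rewrite ltrBlDr ltrDl.
  rewrite in_itv /= => /andP[_ qx]; exists (pickle q).
  by rewrite /real_code pickleK.
have /rat_in_itvoo[q] : (x < x + 1)%R by rewrite ltrDl.
rewrite in_itv /= => /andP[xq _]; exists (pickle q).
by rewrite /real_code pickleK -leNgt ltW.
Qed.

Lemma real_code_inj (R : realType) : injective (@real_code R).
Proof.
have lt (x y : R) : (x < y)%R -> real_code x <> real_code y.
  move=> /rat_in_itvoo[q]; rewrite in_itv /= => /andP[xq qy].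
  move=> /(congr1 (@^~ (pickle q))); rewrite /real_code !pickleK qy.
  by rewrite ltNge (ltW xq).
move=> x y E; have [/lt//|/lt|//] := ltgtP x y.
by move=> /(_ (esym E)).
Qed.

Definition real_coding (R : realType) (s : real_seq R) : nat -> cantor_space :=
  coding (fun i => real_code (s i)).

Lemma real_coding_trace (R : realType) (s t : real_seq R) :
  trace (real_coding s) = trace (real_coding t) <-> range s = range t.
Proof.
have rangeE (u : real_seq R) :
    range (fun i => real_code (u i)) = @real_code R @` range u.
  by rewrite image_comp.
split=> E.
  have : range (fun i => real_code (s i)) = range (fun i => real_code (t i)).
    by apply/seteqP; split; apply: trace_coding_sub => [i|i|];
      by [exact: real_code_proper|rewrite -/(real_coding _) E].
  by rewrite !rangeE => /(image_set_inj (@real_code_inj R)).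
by apply/seteqP; split; apply: coding_trace_sub; rewrite !rangeE E.
Qed.

Lemma measurable_real_seq_gt (R : realType) i (a : R) :
  measurable [set s : real_seq R | (a < s i)%R].
Proof.
apply: sub_sigma_algebra.
apply: (@open_comp (prod_topology (fun _ : nat => R)) R (fun h => h i)
  [set x | (a < x)%R]); last exact: open_gt.
by move=> h _; exact: (@proj_continuous _ (fun _ : nat => R) i h).
Qed.

Lemma measurable_iter_odometer d (X : measurableType d)
    (x : X -> cantor_space) b :
  (forall k, measurable [set s | x s k]) ->
  forall k, measurable [set s | iter b odometer (x s) k].
Proof.
move=> mx; elim: b => //= b IH k.
(* A digit of the odometer is an exclusive or, that is, a negated equivalence. *)
rewrite (_ : [set s | _] = [set s | ~ (iter b odometer (x s) k <->
    forall i, (i < k)%N -> iter b odometer (x s) i)]).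
  apply: measurable_neg; apply: measurable_iff => //.
  apply: measurable_forall => i; apply: measurable_imply => //.
  exact: measurable_prop.
apply/seteqP; split=> s /=; rewrite {1}/odometer; set y := iter b odometer (x s).
  move=> yk E; suff yE : y k = all y (iota 0 k) by rewrite yE addbb in yk.
  apply/idP/allP => [/E h i|h]; first by rewrite mem_iota => /h.
  by apply/E => i ik; apply: h; rewrite mem_iota.
move=> nE; apply/negPn/negP => /negbTE yk; apply: nE.
have {yk}yE : y k = all y (iota 0 k)
  by move: yk; rewrite /odometer; case: (y k); case: (all _ _).
rewrite yE; split=> [/allP h i ik|h]; first by apply: h; rewrite mem_iota.
by apply/allP => i; rewrite mem_iota => /h.
Qed.

Lemma measurable_real_coding (R : realType) n k :
  measurable [set s : real_seq R | real_coding s n k].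
Proof.
rewrite /real_coding /coding.
case: (unpickle k) => [[j|[[i a] b]]|]; try exact: measurable_prop.
have my l : measurable [set s : real_seq R |
    iter b odometer (spread (real_code (s i))) l].
  apply: measurable_iter_odometer => {}l; rewrite /spread /real_code.
  case: (unpickle _) => [q|]; last exact: measurable_prop.
  exact: measurable_real_seq_gt.
have ma l : measurable [set s : real_seq R | agree l
    (iter a odometer (base_orbit n)) (iter b odometer (spread (real_code (s i))))].
  by apply: measurable_agree => // ?; exact: measurable_prop.
rewrite (_ : [set s | _] = [set s : real_seq R | exists l, odd l /\
    (agree l (iter a odometer (base_orbit n))
      (iter b odometer (spread (real_code (s i)))) /\
    ~ agree l.+1 (iter a odometer (base_orbit n))
      (iter b odometer (spread (real_code (s i)))))]).
  apply: measurable_exists => l; apply: measurable_conj; first exact: measurable_prop.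
  by apply: measurable_conj => //; exact: measurable_neg.
apply/seteqP; split=> s /=; first by move=> /asboolP[l [? ? ?]]; exists l.
by move=> [l [? [? ?]]]; apply/asboolP; exists l.
Qed.

(** [phi] may come from the axiom of choice: since the orbit [p s] is dense, whether [phi s] maps
    [A] to [B] is decided by the countably many conditions relating [p s n] in [A] to [p s n.+1] in
    [B]. *)
Lemma measurable_to_minimal_homeo d (X : measurableType d)
    (phi : X -> cantor_minimal_homeo) (p : X -> nat -> cantor_space) :
  (forall s n, orbit_seq (set_val (phi s)) (p s 0%N) n = p s n) ->
  (forall n k, measurable [set s | p s n k]) ->
  measurable_fun setT (phi : X -> minimal_homeo_borel).
Proof.
move=> phip mp _ _ [W mW <-]; rewrite !setTI.
have mA (A : cantor_clopen) n : measurable [set s | set_val A (p s n)].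
  have [oA _] := cantor_clopenP A.
  rewrite -[X in measurable X]setTI.
  apply: (measurable_to_cantor (mp n)) => //; exact: sub_sigma_algebra.
have actE s A B : clopen_action (phi s) A = B <->
    forall n, set_val A (p s n) <-> set_val B (p s n.+1).
  split=> [/clopen_actionE AB n|AB].
    by rewrite -(phip s n) -(phip s n.+1); exact: AB.
  apply/clopen_actionE => z.
  have [hphi mphi] := minimal_homeoP (phi s).
  have [[cphi _] _] := minimal_homeoP (phi s).
  have [K KA] := clopen_uniform (cantor_clopenP A).
  have [J JB] := clopen_uniform (cantor_clopenP B).
  have [L LP] := continuous_uniform cphi J.
  have [n zn] := minimal_dense (p s 0%N) hphi mphi z (maxn K L).
  have znK := agree_le (leq_maxl K L) zn.
  have znJ := LP _ _ (agree_le (leq_maxr K L) zn).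
  rewrite phip in znK.
  rewrite -[set_val _ (orbit_seq _ _ n)]/(orbit_seq _ _ n.+1) phip in znJ.
  split=> [/(KA _ _ znK)/AB|/(JB _ _ znJ)/AB]; first exact/JB/agree_sym.
  exact/KA/agree_sym.
suff : measurable_fun setT ((clopen_action \o phi) :
    X -> g_sigma_algebraType (@open clopen_self_maps)).
  by move=> /(_ measurableT _ mW); rewrite setTI.
apply: (@measurability _ _ _ (g_sigma_algebraType (@open clopen_self_maps)) _ _
  (@open clopen_self_maps)) => //.
move=> _ [U oU <-]; rewrite setTI.
pose e k : cantor_clopen :=
  if unpickle k is Some c then prefix_clopen c else point.
have eP A : exists k, e k = A.
  by have [c <-] := prefix_clopen_surj A; exists (pickle c); rewrite /e pickleK.
apply: (@measurable_prod_topology _ _ cantor_clopen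
  (discrete_topology cantor_clopen) e (fun l => [set e l])) => //.
- move=> A U' /nbhs_singleton UA; have [l lA] := eP A; exists l.
  by rewrite lA; split=> // _ ->.
- move=> k l; rewrite (_ : [set s | _] = [set s | forall n,
    set_val (e k) (p s n) <-> set_val (e l) (p s n.+1)]).
    by apply: measurable_forall => n; exact: measurable_iff.
  by apply/seteqP; split=> s /=; rewrite actE.
Qed.

Lemma Delta_plus_reducible_conjugacy (R : realType) :
  @borel_reducible _ _ (real_seq R) pointed_minimal_system
    (@Delta_plus R) pointed_conjugacy.
Proof.
pose p (s : real_seq R) := split_seq (real_coding s).
have proper (s : real_seq R) i := real_code_proper (s i).
have perf (s : real_seq R) : perfect_seq (real_coding s) by exact: coding_perfect (proper s).
have /choice[phi phiP] : forall s : real_seq R, exists phi : cantor_minimal_homeo,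
    forall n, orbit_seq (set_val phi) (p s 0%N) n = p s n.
  move=> s; have [||||phi [hphi mphi phip]] := @split_seq_realize (real_coding s).
  - exact: perf.
  - exact: coding_toeplitz (proper s).
  - exact: coding_forward.
  - exact: coding_backward.
  - have phiA : phi \in [set phi : cantor_space -> cantor_space |
        homeomorphism phi /\ minimal phi] by rewrite inE.
    by exists (exist _ phi phiA).
have mp n k : measurable [set s | p s n k].
  by apply: measurable_split_seq; exact: measurable_real_coding.
exists (fun s => (phi s, p s 0%N) : pointed_minimal_system).
  apply: (@measurable_fun_pair _ _ _ (real_seq R) minimal_homeo_borel
    (g_sigma_algebraType (@open cantor_space))).
    exact: measurable_to_minimal_homeo phiP mp.
  exact: measurable_to_cantor.
move=> s t; rewrite conjugacy_trace /Delta_plus -real_coding_trace.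
have orbE u : system_orbit (phi u, p u 0%N) = p u.
  by apply/funext => n; exact: phiP.
by rewrite !orbE !split_seq_trace.
Qed.

Theorem theorem1p2 (R : realType) :
  @borel_bireducible _ _ (real_seq R) pointed_minimal_system
    (@Delta_plus R) pointed_conjugacy.
Proof.
split; [exact: Delta_plus_reducible_conjugacy|].
exact: conjugacy_reducible_Delta_plus.
Qed.
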